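(* For $r \geq 2$, let $K_{n_1,n_2,\dots,n_r}$ be the complete multipartite graph with partite sets $V_1,V_2,\dots,V_r$, where $n_i = |V_i|$ and $n_1 \geq n_2 \geq \dots \geq n_r \geq 1$. Set $n = \sum_{i=1}^{r} n_i$. If the vertex $x$ lies in $V_i$, then \[ p_x(K_{n_1,n_2,\dots,n_r}) = \max\{ n - n_i,\, n_i - 1 \}. \] Thus $\mathrm{vp}(K_{n_1,n_2,\dots,n_r}) = n - n_r$.
   Context: All graphs are finite, undirected and simple. A $u,v$-geodesic is a shortest $u,v$-path. For a vertex $x$ of $G$, a set $S \subseteq V(G)$ is an $x$-position set if for every $y \in S$ no vertex of $S \setminus \{y\}$ lies on any $x,y$-geodesic in $G$. The $x$-position number $p_x(G)$ is the maximum cardinality of an $x$-position set of $G$. Define $\mathrm{vp}(G) = \max_{x \in V(G)} p_x(G)$. *)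

(* Defs.v *)
From mathcomp Require Import all_boot boolp.

Set Implicit Arguments.
Unset Strict Implicit.
Unset Printing Implicit Defensive.

Record sgraph := SGraph {
  vertex :> finType;
  adj : rel vertex;
  adj_sym : symmetric adj;
  adj_irrefl : irreflexive adj
}.

(* A walk from [x] is represented, as in [path], by its start [x] and the
   sequence [p] of the vertices that follow it. *)
Definition geodesic (G : sgraph) (x y : G) (p : seq G) : Prop :=
  [/\ path (@adj G) x p, last x p = y
    & forall q : seq G, path (@adj G) x q -> last x q = y -> size p <= size q].

Definition position_set (G : sgraph) (x : G) (S : {set G}) : Prop :=
  forall y, y \in S -> forall z, z \in S :\ y ->
  forall p, geodesic x y p -> z \notin x :: p.

Definition position_number (G : sgraph) (x : G) : nat :=
  \max_(S : {set G} | `[< position_set x S >]) #|S|.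

Definition vp (G : sgraph) : nat := \max_(x : G) position_number x.

Definition complete_multipartite (G : sgraph) (r : nat)
    (V : 'I_r -> {set G}) : Prop :=
  [/\ forall i j, i != j -> [disjoint V i & V j],
      \bigcup_i V i = [set: G]
    & forall i j u v, u \in V i -> v \in V j -> adj u v = (i != j)].

Definition last_index (r : nat) (hr : 2 <= r) : 'I_r :=
  Ordinal (etrans (ltn_predL r) (ltnW hr)).

(* Main.v *)
(* From x in V_i, a vertex outside V_i is at distance 1 and another vertex of
   V_i is at distance 2, the middle vertex being any vertex outside V_i.  Hence
   an x-position set avoiding x lies inside V_i :\ x or inside ~: V_i, and both
   of these are x-position sets; one containing x is just [set x]. *)
Require Import Defs.
From mathcomp Require Import all_boot boolp.

Set Implicit Arguments.
Unset Strict Implicit.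

(** The edge itself is a competing walk, so a geodesic has at most one step; having no step would
    force [x = y], against irreflexivity. *)
Lemma geodesic_adj (G : sgraph) (x y : G) (p : seq G) :
  adj x y -> geodesic x y p -> p = [:: y].
Proof.
move=> xy [p_path p_last p_min].
have := p_min [:: y]; rewrite /= xy => /(_ isT erefl).
case: p p_last {p_path p_min} => [/= eq_xy | u [|//] /= -> //].
by rewrite eq_xy adj_irrefl in xy.
Qed.

Lemma adj_geodesic (G : sgraph) (x y : G) : adj x y -> geodesic x y [:: y].
Proof.
move=> xy; split=> [||[|//] _ /= eq_xy] //=; first by rewrite xy.
by rewrite eq_xy adj_irrefl in xy.
Qed.

Lemma common_neighbor_geodesic (G : sgraph) (x y z : G) :
  x != y -> ~~ adj x y -> adj x z -> adj z y -> geodesic x y [:: z; y].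
Proof.
move=> neq_xy nxy xz zy; split=> //=; first by rewrite xz zy.
case=> [_ /= eq_xy | u [/= /andP[xu _] eq_uy | //]].
  by rewrite eq_xy eqxx in neq_xy.
by rewrite -eq_uy xu in nxy.
Qed.

(** The walk through [z] bounds the length of the geodesic by 2, so a vertex other than both ends
    can only be the middle one, and the last step is an edge from it to [y]. *)
Lemma inner_geodesic_adj (G : sgraph) (x y z w : G) (p : seq G) :
  adj x z -> adj z y -> geodesic x y p ->
  w \in x :: p -> w != x -> w != y -> adj w y.
Proof.
move=> xz zy [p_path p_last p_min].
have := p_min [:: z; y]; rewrite /= xz zy => /(_ isT erefl).
case: p p_path p_last {p_min} => [|u [|v [|//]]] /=.
- by rewrite inE => _ _ _ /eqP ->; rewrite eqxx.
- by move=> _ <- _; rewrite !inE => /orP[] ->.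
by move=> /and3P[_ uv _] <- _; rewrite !inE => /or3P[] /eqP ->; rewrite ?eqxx.
Qed.

Lemma leq_position_number (G : sgraph) (x : G) (S : {set G}) :
  position_set x S -> #|S| <= position_number x.
Proof.
move=> S_pos; rewrite /position_number.
by apply: (@leq_bigmax_cond _ _ (fun S : {set G} => #|S|)); apply/asboolP.
Qed.

Lemma position_number_leq (G : sgraph) (x : G) (m : nat) :
  (forall S : {set G}, position_set x S -> #|S| <= m) -> position_number x <= m.
Proof. by move=> le_m; apply/bigmax_leqP => S /asboolP; apply: le_m. Qed.

Section CompleteMultipartite.

Context {G : sgraph} {r : nat} {V : 'I_r -> {set G}}.
Hypothesis V_multipartite : complete_multipartite V.

Lemma part_exists (u : G) : exists i, u \in V i.
Proof.
case: V_multipartite => _ V_cover _.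
by have /bigcupP[i _ ui] : u \in \bigcup_i V i by [rewrite V_cover inE]; exists i.
Qed.

Lemma adj_part (i : 'I_r) (u : G) :
  u \in V i -> forall v, adj u v = (v \notin V i).
Proof.
case: V_multipartite => V_disj _ V_adj ui v; have [j vj] := part_exists v.
rewrite (V_adj i j) //; have [-> | neq_ij] := eqVneq i j; first by rewrite vj.
by rewrite (disjointFl (V_disj i j neq_ij)).
Qed.

Lemma card_multipartite : \sum_i #|V i| = #|G|.
Proof.
case: V_multipartite => V_disj V_cover _.
rewrite -cardsT -V_cover -[RHS]sum1_card partition_disjoint_bigcup //.
by apply: eq_bigr => i _; rewrite sum1_card.
Qed.

Lemma position_set_setC (i : 'I_r) (x : G) :
  x \in V i -> position_set x (~: V i).
Proof.
move=> xi y; rewrite inE => yi z; rewrite !inE => /andP[neq_zy zi] p p_geo.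
have -> : p = [:: y] by apply: geodesic_adj p_geo; rewrite (adj_part xi).
rewrite !inE negb_or neq_zy andbT.
(* What remains is [z != x]: [x] lies in [V i] and [z] does not. *)
by apply: contraNneq zi => ->.
Qed.

(** An inner vertex of a geodesic ending at [y] is adjacent to [y], hence outside [V i]. The vertex
    [z] serves as the common neighbour of [x] and [y]. *)
Lemma position_set_part (i : 'I_r) (x z : G) :
  x \in V i -> z \notin V i -> position_set x (V i :\ x).
Proof.
move=> xi zi y /setD1P[_ yi] w /setD1P[neq_wy /setD1P[neq_wx wi]] p p_geo.
apply/negP => wp; have : adj w y.
  apply: (inner_geodesic_adj (z := z) _ _ p_geo) => //.
    by rewrite (adj_part xi).
  by rewrite adj_sym (adj_part yi).
by rewrite (adj_part wi) yi.
Qed.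

Lemma position_set_leq (i : 'I_r) (x z : G) (S : {set G}) :
  x \in V i -> z \notin V i -> position_set x S ->
  #|S| <= maxn #|~: V i| #|V i :\ x|.
Proof.
move=> xi zi S_pos; rewrite leq_max.
have adj_V y w : y \in V i -> w \notin V i -> adj y w.
  by move=> yi wi; rewrite (adj_part yi).
have [xS | xS] := boolP (x \in S).
  (* Every geodesic from [x] contains [x], so [S] has no other element. The bound then reads
     [1 <= #|~: V i|], witnessed by [z]. *)
  suff /eqP -> : S == [set x].
    by rewrite cards1 card_gt0; apply/orP; left; apply/set0Pn; exists z; rewrite inE.
  rewrite eqEsubset sub1set xS andbT; apply/subsetP => y yS.
  rewrite inE; apply/negPn/negP => neq_yx.
  have xSy : x \in S :\ y by rewrite !inE eq_sym neq_yx.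
  have [yi | yi] := boolP (y \in V i).
    have y_geo : geodesic x y [:: z; y].
      apply: common_neighbor_geodesic.
      - by rewrite eq_sym.
      - by rewrite (adj_part xi) yi.
      - exact: adj_V.
      - by rewrite adj_sym adj_V.
    by have := S_pos y yS x xSy _ y_geo; rewrite mem_head.
  by have := S_pos y yS x xSy _ (adj_geodesic (adj_V _ _ xi yi)); rewrite mem_head.
have [S_out | ] := boolP (S \subset ~: V i); first by rewrite subset_leq_card.
case/subsetPn => y yS; rewrite inE negbK => yi.
apply/orP; right; apply: subset_leq_card; apply/subsetP => w wS.
rewrite !inE (contraNneq _ xS) => [/= | <- //].
(* An element [w] of [S] outside [V i] would itself be the middle vertex of a geodesic from [x] to
   [y]. *)
apply/negPn/negP => wi.
have y_geo : geodesic x y [:: w; y].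
  apply: common_neighbor_geodesic.
  - by apply: contraNneq xS => ->.
  - by rewrite (adj_part xi) yi.
  - exact: adj_V.
  - by rewrite adj_sym adj_V.
have wSy : w \in S :\ y by rewrite !inE wS andbT; apply: contraNneq wi => ->.
by have := S_pos y yS w wSy _ y_geo; rewrite !inE eqxx orbT.
Qed.

Lemma position_number_multipartite (i : 'I_r) (x z : G) :
  x \in V i -> z \notin V i ->
  position_number x = maxn #|~: V i| #|V i :\ x|.
Proof.
move=> xi zi; apply/eqP; rewrite eqn_leq geq_max; apply/and3P; split.
- by apply: position_number_leq => S; apply: position_set_leq xi zi.
- exact/leq_position_number/position_set_setC.
- exact/leq_position_number/(position_set_part xi zi).
Qed.

End CompleteMultipartite.

Theorem theorem3p3 (r : nat) (hr : 2 <= r) (n : 'I_r -> nat)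
    (n_decr : forall i j : 'I_r, i <= j -> n j <= n i)
    (n_pos : forall i : 'I_r, 1 <= n i)
    (G : sgraph) (V : 'I_r -> {set G})
    (G_multipartite : complete_multipartite V)
    (card_V : forall i : 'I_r, #|V i| = n i) :
  (forall (i : 'I_r) (x : G), x \in V i ->
     position_number x = maxn ((\sum_(j < r) n j) - n i) (n i - 1)) /\
  vp G = (\sum_(j < r) n j) - n (last_index hr).
Proof.
set l := last_index hr.
have sum_n : \sum_(j < r) n j = #|G|.
  rewrite -(card_multipartite G_multipartite).
  by apply: eq_bigr => j _; rewrite card_V.
(* [hr] is also a proof of [1 < r], so [Ordinal hr] is the index 1; one of the indices 0 and 1
   differs from [i]. *)
have other (i : 'I_r) : exists j, j != i.
  have r_gt0 : 0 < r by apply: ltnW.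
  have [->|ni0] := eqVneq i (Ordinal r_gt0); first by exists (Ordinal hr).
  by exists (Ordinal r_gt0); rewrite eq_sym.
have add_le i j : i != j -> n i + n j <= \sum_(k < r) n k.
  by move=> neq_ij; rewrite (bigD1 i) //= (bigD1 j) 1?eq_sym //= addnA leq_addr.
have n_last i : n l <= n i.
  by apply: n_decr; rewrite /= -ltnS prednK ?ltn_ord // ltnW.
have pos_num i x : x \in V i ->
    position_number x = maxn ((\sum_(j < r) n j) - n i) (n i - 1).
  move=> xi; have [j neq_ji] := other i.
  have /card_gt0P[z zj] : 0 < #|V j| by rewrite card_V.
  have zi : z \notin V i.
    by case: G_multipartite => V_disj _ _; rewrite (disjointFr (V_disj j i neq_ji)).
  rewrite (position_number_multipartite G_multipartite xi zi).
  by rewrite sum_n -card_V cardsCs setCK (cardsD1 x (V i)) xi addKn.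
split=> //; apply/eqP; rewrite eqn_leq; apply/andP; split.
  apply/bigmax_leqP => x _.
  have [i xi] := part_exists G_multipartite x.
  rewrite (pos_num i x xi) geq_max leq_sub2l ?n_last //=.
  (* The stronger bound [n i <= \sum_(j < r) n j - n l] already holds. For [i != l] the two parts
     are distinct summands; for [i = l], another part [j] has [n l <= n j] and takes the place of
     one copy of [n l]. *)
  apply: leq_trans (leq_subr 1 _) _; rewrite leq_psubRL ?n_pos // addnC.
  have [-> | neq_il] := eqVneq i l; last exact: add_le.
  have [j neq_jl] := other l.
  by apply: leq_trans (add_le _ _ neq_jl); rewrite leq_add2r.
(* The maximum is attained at any vertex of a smallest part. *)
have /card_gt0P[x xl] : 0 < #|V l| by rewrite card_V.
apply: leq_trans (@leq_bigmax _ (fun x : G => position_number x) x).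
by rewrite (pos_num l x xl) leq_maxl.
Qed.
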